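(* Let $\alpha,\beta,t_0$ be real numbers with $\beta\ge0$, $t_0>0$, let $u_0,v_0\in\mathcal{H}$, and let $x:[t_0,+\infty)\to\mathcal{H}$ be the unique global $C^2$-solution of $$\ddot{x}(t)+\frac{\alpha}{t}\dot{x}(t)+\beta\nabla^2 g(x(t))\dot{x}(t)+\nabla g(x(t))+\epsilon(t)x(t)=0\quad (t\ge t_0),\qquad x(t_0)=u_0,\ \dot{x}(t_0)=v_0.$$ Assume that $$\int_{t_0}^{+\infty}\frac{\epsilon(t)}{t}\,dt=+\infty.$$ Let $x^*=\operatorname{argmin}\{\|x\|: x\in\operatorname{argmin} g\}$ be the element of minimum norm of the nonempty convex closed set $\operatorname{argmin} g$. If $\alpha>0$, then $$\lim_{t\to+\infty}\frac{1}{\int_{t_0}^{t}\frac{\epsilon(s)}{s}\,ds}\int_{t_0}^{t}\frac{\epsilon(s)}{s}\|x(s)-x^*\|^2\,ds=0\quad\text{and}\quad \liminf_{t\to+\infty}\|x(t)-x^*\|=0.$$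
   Context: $\mathcal{H}$ is a real Hilbert space. Standing assumptions: $g:\mathcal{H}\to\mathbb{R}$ is convex and twice Fréchet differentiable, its gradient $\nabla g$ is Lipschitz continuous on bounded sets, and $\operatorname{argmin} g\ne\emptyset$; $\epsilon:[t_0,+\infty)\to[0,+\infty)$ is nonincreasing, of class $C^1$, with $\lim_{t\to+\infty}\epsilon(t)=0$. *)

(* Defs.v *)
From mathcomp Require Import all_boot all_order all_algebra.
From mathcomp Require Import all_classical all_reals all_analysis.
From mathcomp Require Import ring lra.

Set Implicit Arguments.
Unset Strict Implicit.
Unset Printing Implicit Defensive.
Import Order.TTheory GRing.Theory Num.Theory.
Import numFieldNormedType.Exports.

Local Open Scope classical_set_scope.
Local Open Scope ring_scope.

(* A Hilbert space is a complete normed module whose norm comes from the inner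
   product [dot], which is carried separately. *)
Definition hilbert_norm (R : realType) (H : completeNormedModType R)
    (dot : {dot H for idfun}) : Prop :=
  forall x : H, `|x| ^+ 2 = dot x x.

Lemma riesz_representation (R : realType) (H : completeNormedModType R)
    (dot : {dot H for idfun}) (f : {linear H -> R}) :
  hilbert_norm dot -> continuous f -> exists v : H, forall h, f h = dot v h.
Proof.
move=> dotE f_cont.
have dotC (u v : H) : dot u v = dot v u.
  by rewrite [LHS](@hermitian_subproof _ _ _ _ dot) mul1r.
have dotDl (w u v : H) : dot (u + v) w = dot u w + dot v w.
  exact: (linearDl dot).
have dotZl (a : R) (u w : H) : dot (a *: u) w = a * dot u w.
  exact: (linearZl_LR dot).
have normD2 (u v : H) : `|u + v| ^+ 2 = `|u| ^+ 2 + `|v| ^+ 2 + 2 * dot u v.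
  rewrite !dotE dotDl (dotC u (u + v)) (dotC v (u + v)) !dotDl (dotC v u); ring.
pose J (u : H) : R := `|u| ^+ 2 / 2 - f u.
have [M M_gt0 fM] : exists2 M : R, 0 < M & forall u, `|f u| <= M * `|u|.
  have /linear_boundedP [r [_ /(_ (`|r| + 1))]] :=
    (linear_bounded_continuous f).2 f_cont.
  rewrite (le_lt_trans (ler_norm r)) ?ltrDl// => /(_ isT) rP.
  by exists (`|r| + 1) => //; apply: ltr_wpDl.
have J_lb : lbound (range J) (- M ^+ 2).
  move=> _ [u _ <-]; rewrite /J.
  have := fM u; rewrite ler_norml => /andP[_].
  by have := sqr_ge0 (`|u| - M); have := sqr_ge0 M; nra.
have J_inf : has_inf (range J) by split; [exists (J 0), 0 | exists (- M ^+ 2)].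
set m := inf (range J).
have m_le u : m <= J u by apply: ge_inf; [exists (- M ^+ 2) | exists u].
have /choice[w wP] : forall n, exists u, J u < m + n.+1%:R^-1.
  move=> n.
  have n_gt0 : 0 < n.+1%:R^-1 :> R by rewrite invr_gt0.
  by have [_ [u _ <-] ?] := inf_adherent n_gt0 J_inf; exists u.
have parallelogram u v : `|u - v| ^+ 2 <= 4 * (J u + J v - 2 * m).
  have := m_le (2^-1 *: (u + v)).
  have fE : f (2^-1 *: (u + v)) = 2^-1 * (f u + f v) by rewrite linearZ linearD.
  rewrite /J fE normrZ exprMn normD2 ger0_norm ?invr_ge0//.
  have -> : `|u - v| ^+ 2 = `|u| ^+ 2 + `|v| ^+ 2 - 2 * dot u v.
    by rewrite normD2 normrN -scaleN1r (dotC u) dotZl (dotC v); ring.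
  lra.
have w_cvg : cvgn w.
  apply/cauchy_cvgP/cauchy_exP => e e_gt0.
  have e2_gt0 : 0 < e ^+ 2 / 8 by rewrite divr_gt0// exprn_gt0.
  have [N _ NP] := near_infty_natSinv_lt (PosNum e2_gt0).
  exists (w N), N => // n /= Nn.
  rewrite -ball_normE /= -(ltr_pXn2r (n := 2)) ?nnegrE ?(ltW e_gt0)//.
  apply: le_lt_trans (parallelogram _ _) _.
  have bound (p q r a b c : R) :
      p < r + a -> q < r + b -> a < c / 8 -> b < c / 8 -> 4 * (p + q - 2 * r) < c.
    by lra.
  exact: bound (wP N) (wP n) (NP N (leqnn N)) (NP n Nn).
set u := limn w.
have Ju : J u <= m.
  have Jw_cvg : J (w n) @[n --> \oo] --> J u.
    apply: cvgB; last exact: (cvg_comp _ _ w_cvg (f_cont u)).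
    apply: cvgM; last exact: cvg_cst.
    by rewrite /GRing.exp; apply: cvgM; apply: cvg_norm.
  have m_cvg : m + n.+1%:R^-1 @[n --> \oo] --> m.
    rewrite -[X in _ --> X]addr0; apply: cvgD; first exact: cvg_cst.
    exact: cvg_harmonic.
  apply: (ler_cvg_to Jw_cvg m_cvg).
  by apply: nearW => n; apply: ltW.
exists u => h.
have Jt t : 0 <= t ^+ 2 * `|h| ^+ 2 / 2 + t * (dot u h - f h).
  have := le_trans Ju (m_le (u + t *: h)).
  have fE : f (u + t *: h) = f u + t * f h by rewrite linearD linearZ.
  rewrite /J fE normD2 normrZ exprMn real_normK ?num_real//.
  rewrite (dotC u) dotZl (dotC h); lra.
set a := `|h| ^+ 2 in Jt; set b := dot u h - f h in Jt.
have a_ge0 : 0 <= a by exact: sqr_ge0.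
suff : b = 0 by move/eqP; rewrite subr_eq0 => /eqP.
have := Jt (- (b / (a + 1))).
have a1 : 0 < a + 1 by rewrite ltr_wpDl.
have -> : (- (b / (a + 1))) ^+ 2 * a / 2 + - (b / (a + 1)) * b
  = - (b ^+ 2 * ((a + 2) / (2 * (a + 1) ^+ 2))).
  by field; rewrite gt_eqF.
rewrite oppr_ge0 pmulr_lle0; last first.
  by rewrite divr_gt0// ?mulr_gt0// ?exprn_gt0// ltr_wpDl.
by move=> b2; apply/eqP; rewrite -sqrf_eq0 eq_le b2 sqr_ge0.
Qed.

(* The Riesz representative of the Fréchet differential; see [gradientP]. *)
Definition gradient (R : realType) (H : completeNormedModType R)
    (dot : {dot H for idfun}) (g : H -> R) (x : H) : H :=
  get [set v : H | forall h : H, 'd g x h = dot v h].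

Lemma gradientP (R : realType) (H : completeNormedModType R)
    (dot : {dot H for idfun}) (g : H -> R) (x : H) :
  hilbert_norm dot -> differentiable g x ->
  forall h, 'd g x h = dot (gradient dot g x) h.
Proof.
move=> dotE /diff_continuous g_cont.
exact: (getPex (riesz_representation dotE g_cont)).
Qed.

(* The second derivative of [g] is identified with the differential of its
   gradient, through the Riesz isometry. *)
Definition hessian (R : realType) (H : completeNormedModType R)
    (dot : {dot H for idfun}) (g : H -> R) (x : H) : H -> H :=
  'd (gradient dot g) x.

Definition twice_differentiable (R : realType) (H : completeNormedModType R)
    (dot : {dot H for idfun}) (g : H -> R) : Prop :=
  (forall x, differentiable g x) /\ (forall x, differentiable (gradient dot g) x).

Definition argmin (R : realType) (T : Type) (A : set T) (f : T -> R) : set T :=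
  [set x | A x /\ forall y, A y -> f x <= f y].

(* Differentiation relative to [D]: one-sided at an endpoint of an interval. *)
Definition is_derive_on (R : realType) (V : normedModType R) (D : set R)
    (f df : R -> V) : Prop :=
  forall t, D t ->
    (s - t)^-1 *: (f s - f t) @[s --> within D t^'] --> df t.

Definition continuously_differentiable_on (R : realType) (V : normedModType R)
    (D : set R) (f : R -> V) : Prop :=
  exists df : R -> V, is_derive_on D f df /\ {within D, continuous df}.

(* Main.v *)
(* Put h = |x - xs|^2 / 2.  Pairing the equation with x - xs, the Hessian term is
   the exact derivative of the Bregman gap K = <grad g(x), x - xs> - (g(x) - min g),
   which is nonnegative, and strong convexity of g + eps/2 |.|^2 leaves
     h'' + (alpha/t) h' + beta K' + eps h <= |x'|^2 + eps delta(t),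
   with delta(t) -> 0 because xs is the minimum-norm minimizer.  After division by t,
   the term |x'|^2 / t is paid for by the mechanical energy W, whose derivative is at
   most -(alpha/t) |x'|^2, and h'/t together with the other boundary terms is collected in
     h'/t + (1 + alpha) h/t^2 + beta K/t + W/alpha,
   which is nonnegative (complete the square) and has derivative at most
   (eps/t) (delta - h).  Integrating bounds the eps/t-weighted integral of h by that of
   delta plus a constant, and the integral of eps/t diverges. *)
Require Import Defs.
From mathcomp Require Import all_boot all_order all_algebra.
From mathcomp Require Import all_classical all_reals all_analysis.
From mathcomp Require Import ring lra.
Import Order.TTheory GRing.Theory Num.Theory.
Import numFieldNormedType.Exports.

Local Open Scope classical_set_scope.
Local Open Scope ring_scope.

(** * Inner product calculus *)

Section inner_product.
Context {R : realType} {H : completeNormedModType R} (dot : {dot H for idfun}).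
Hypothesis dotE : hilbert_norm dot.

Lemma dotC u v : dot u v = dot v u.
Proof. by rewrite [LHS](@hermitian_subproof _ _ _ _ dot) mul1r. Qed.

Lemma dotDl w u v : dot (u + v) w = dot u w + dot v w.
Proof. exact: (linearDl dot). Qed.

Lemma dotZl (a : R) u w : dot (a *: u) w = a * dot u w.
Proof. exact: (linearZl_LR dot). Qed.

Lemma dotDr w u v : dot w (u + v) = dot w u + dot w v.
Proof. by rewrite dotC dotDl !(dotC _ w). Qed.

Lemma dotZr (a : R) u w : dot w (a *: u) = a * dot w u.
Proof. by rewrite dotC dotZl (dotC w). Qed.

Lemma dotNl u w : dot (- u) w = - dot u w.
Proof. by rewrite -scaleN1r dotZl mulN1r. Qed.

Lemma dotNr u w : dot w (- u) = - dot w u.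
Proof. by rewrite dotC dotNl (dotC w). Qed.

Lemma dotBl w u v : dot (u - v) w = dot u w - dot v w.
Proof. by rewrite dotDl dotNl. Qed.

Lemma dotBr w u v : dot w (u - v) = dot w u - dot w v.
Proof. by rewrite dotDr dotNr. Qed.

Lemma sqr_normD u v : `|u + v| ^+ 2 = `|u| ^+ 2 + `|v| ^+ 2 + 2 * dot u v.
Proof. rewrite !dotE dotDl !dotDr (dotC v u); ring. Qed.

Lemma sqr_normB u v : `|u - v| ^+ 2 = `|u| ^+ 2 + `|v| ^+ 2 - 2 * dot u v.
Proof. rewrite sqr_normD normrN dotNr; ring. Qed.

(** Polarization reduces the continuity of [dot] to that of the norm, which is how [cvg_dot] is
    obtained. *)
Lemma dot_polar u v : dot u v = (`|u + v| ^+ 2 - `|u - v| ^+ 2) / 4.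
Proof. rewrite sqr_normD sqr_normB; lra. Qed.

Lemma cvg_dot {T : Type} {F : set_system T} {FF : Filter F} (f g : T -> H) a b :
  f t @[t --> F] --> a -> g t @[t --> F] --> b ->
  dot (f t) (g t) @[t --> F] --> dot a b.
Proof.
move=> fa gb; rewrite dot_polar; under eq_cvg do rewrite dot_polar.
apply: cvgM; last exact: cvg_cst.
rewrite /GRing.exp; apply: cvgB.
  by apply: cvgM; apply: cvg_norm; apply: cvgD.
by apply: cvgM; apply: cvg_norm; apply: cvgB.
Qed.

Lemma is_derive_dot (f g : R -> H) (t : R) (df dg : H) :
  is_derive t 1 f df -> is_derive t 1 g dg ->
  is_derive t 1 (fun s => dot (f s) (g s)) (dot df (g t) + dot (f t) dg).
Proof.
move=> fdf gdg.
have cg : (g \o shift t) h @[h --> 0^'] --> g t.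
  apply/continuous_withinNshiftx/differentiable_continuous/derivable1_diffP.
  by case: gdg.
have quot (u : R -> H) du : is_derive t 1 u du ->
    h^-1 *: ((u \o shift t) (h *: 1) - u t) @[h --> 0^'] --> du.
  by case=> + <-.
have lim : h^-1 *: (((fun s => dot (f s) (g s)) \o shift t) (h *: 1)
    - dot (f t) (g t)) @[h --> 0^'] --> (dot df (g t) + dot (f t) dg : R^o).
  (* The quotient splits as [dot] of the quotient of [f] with the shifted [g], plus [dot] of [f t]
     with the quotient of [g]. *)
  have /(_ _ _ _ _) L := cvgD (cvg_dot _ _ _ _ (quot _ _ fdf) cg)
               (cvg_dot _ _ _ _ (cvg_cst (f t)) (quot _ _ gdg)).
  apply: cvg_trans L; apply: near_eq_cvg; near=> h.
  rewrite !fctE /= dotZl dotZr -mulrDr; congr (_ * _).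
  by rewrite [_%:A]mulr1 dotBl dotBr; ring.
by split; [apply/cvg_ex; eexists; exact: lim | apply/cvg_lim].
Unshelve. all: by end_near. Qed.

End inner_product.

(** * Differentials along lines and curves *)

Section differential.
Context {R : realType} {V W : normedModType R}.

Lemma diff_quotient_cvg (f : V -> W) (a v : V) : differentiable f a ->
  h^-1 *: (f (h *: v + a) - f a) @[h --> 0^'] --> 'd f a v.
Proof. by move=> fa; rewrite -deriveE//; exact: diff_derivable. Qed.

Lemma is_derive_diff_comp (f : V -> W) (u : R -> V) (t : R) (du : V) :
  is_derive t 1 u du -> differentiable f (u t) ->
  is_derive t 1 (f \o u) ('d f (u t) du).
Proof.
move=> udu fu.
have ut : differentiable u t by apply/derivable1_diffP; case: udu.
split; first by apply/derivable1_diffP; exact: differentiable_comp.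
rewrite deriveE; last exact: differentiable_comp.
by rewrite diff_comp//=; congr ('d f _ _); rewrite -deriveE//; case: udu.
Qed.

End differential.

(** * Convexity: gradient, Hessian and Tikhonov regularization *)

Section convex_differentiable.
Context {R : realType} {H : completeNormedModType R} (dot : {dot H for idfun}).
Hypothesis dotE : hilbert_norm dot.
Variable g : H -> R.
Hypothesis g_convex : convex_function (setT : set (convex_lmodType H)) g.

Lemma convex_function_ler (s : R) (u v : H) : 0 <= s -> s <= 1 ->
  g (s *: u + (1 - s) *: v) <= s * g u + (1 - s) * g v.
Proof.
by move=> s0 s1; have := g_convex (Itv01 s0 s1); apply; rewrite inE.
Qed.

(** By convexity the chord slopes from [u] towards [v] are at most [g v - g u]; let the step tend to
    0 from the right. *)
Lemma convex_gradient_le (u v : H) : differentiable g u ->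
  g u + dot (gradient dot g u) (v - u) <= g v.
Proof.
move=> gu; rewrite -lerBrDl -gradientP//.
apply: (cvgr_to_le (cvg_dnbhs_at_right (diff_quotient_cvg g u (v - u) gu))).
near=> h.
have h0 : 0 < h by [].
have h1 : h <= 1 by near: h; apply: nbhs_right_le.
have := convex_function_ler h v u (ltW h0) h1.
have -> : h *: v + (1 - h) *: u = h *: (v - u) + u.
  by rewrite scalerBl scale1r scalerBr addrCA addrC.
move=> gh; rewrite -[leLHS]/(h^-1 * _) ler_pdivrMl//; lra.
Unshelve. all: by end_near. Qed.

(** The gradient is monotone: adding the gradient inequalities between [u] and [h *: v + u] makes
    its difference quotients nonnegative along [v], and the sign passes to the limit. *)
Lemma hessian_ge0 (u v : H) : twice_differentiable dot g ->
  0 <= dot (hessian dot g u v) v.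
Proof.
move=> [g1 g2].
have L : dot (h^-1 *: (gradient dot g (h *: v + u) - gradient dot g u)) v
    @[h --> 0^'+] --> dot (hessian dot g u v) v.
  apply: (cvg_dot _ dotE _ _ _ _ _ (cvg_cst v)).
  exact: cvg_dnbhs_at_right (diff_quotient_cvg _ u v (g2 u)).
apply: (cvgr_to_ge L).
near=> h.
have h0 : 0 < h by [].
rewrite (dotZl dot) pmulr_rge0 ?invr_gt0// (dotBl dot).
have uE : u - (h *: v + u) = - (h *: v) by rewrite opprD addrCA subrr addr0.
have vE : h *: v + u - u = h *: v by rewrite addrK.
have := convex_gradient_le (h *: v + u) u (g1 _).
rewrite uE (dotNr dot) (dotZr dot) => above.
have := convex_gradient_le u (h *: v + u) (g1 _).
rewrite vE (dotZr dot) => below.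
move: (dot (gradient dot g u) v) (dot (gradient dot g (h *: v + u)) v) above below.
by move=> a b above below; rewrite -(pmulr_rge0 _ h0); lra.
Unshelve. all: by end_near. Qed.

(** This is the source of delta(t) -> 0: with [e] standing for eps(t), the infimum of g + e |.|^2 /
    2 falls below its value at [xs] by only o(e). *)
Lemma tikhonov_lower_bound (xs : H) (eta : R) : continuous g ->
  argmin (argmin setT g) (fun y => `|y|) xs -> 0 < eta ->
  exists2 d, 0 < d & forall e y, 0 <= e -> e <= d ->
    g xs + e * (`|xs| ^+ 2 / 2 - eta) <= g y + e * (`|y| ^+ 2 / 2).
Proof.
move=> g_cont [[_ g_min] norm_min] eta_gt0.
(* Near-minimizers of the functionals [F n], which increase with [n], are Cauchy by
   the parallelogram law; their limit minimizes [g], so [inf F n] increases to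
   [|xs|^2 / 2]. *)
pose F (n : nat) (y : H) : R := (g y - g xs) * n.+1%:R + `|y| ^+ 2 / 2.
have gB y : 0 <= g y - g xs by rewrite subr_ge0 g_min.
have sq (y : H) : 0 <= `|y| ^+ 2 / 2 :> R by rewrite divr_ge0 ?sqr_ge0.
have F_mono n k y : (n <= k)%N -> F n y <= F k y.
  by move=> nk; rewrite lerD2r ler_wpM2l// ler_nat.
have F_lb n : lbound (range (F n)) 0.
  by move=> _ [y _ <-]; rewrite addr_ge0// mulr_ge0.
have F_inf n : has_inf (range (F n)) by split; [exists (F n 0), 0 | exists 0].
pose m n := inf (range (F n)).
have m_le n y : m n <= F n y by apply: ge_inf; [exists 0 | exists y].
have m_mono : {homo m : n k / (n <= k)%N >-> n <= k}.
  move=> n k nk; apply: lb_le_inf; first by exists (F k 0), 0.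
  by move=> _ [y _ <-]; apply: le_trans (m_le n y) (F_mono _ _ _ nk).
have m_xs n : m n <= `|xs| ^+ 2 / 2.
  by apply: le_trans (m_le n xs) _; rewrite /F subrr mul0r add0r.
have m_ub : has_ubound (range m) by exists (`|xs| ^+ 2 / 2) => _ [n _ <-].
have m_cvg : m @ \oo --> limn m.
  exact: nondecreasing_is_cvgn.
set l := limn m in m_cvg.
have m_l n : m n <= l by apply: nondecreasing_cvgn_le => //; apply/cvg_ex; exists l.
have /choice[w wP] : forall n, exists y, F n y < m n + n.+1%:R^-1.
  move=> n.
  have n_gt0 : 0 < n.+1%:R^-1 :> R by rewrite invr_gt0.
  by have [_ [y _ <-] ?] := inf_adherent n_gt0 (F_inf n); exists y.
(* At the midpoint, [F n] lies below the average of its values at [u] and [v] by at least |u - v|^2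
   / 8, yet stays above [m n]. *)
have parallelogram n u v : `|u - v| ^+ 2 <= 4 * (F n u + F n v - 2 * m n).
  have := m_le n (2^-1 *: u + (1 - 2^-1) *: v).
  have h0 : 0 <= 2^-1 :> R by rewrite invr_ge0.
  have h1 : 2^-1 <= 1 :> R by lra.
  have := convex_function_ler 2^-1 u v h0 h1; rewrite /F.
  have -> : 1 - 2^-1 = 2^-1 :> R by lra.
  rewrite (sqr_normD dot dotE) (sqr_normB dot dotE) !normrZ !exprMn ger0_norm//.
  rewrite (dotZl dot) (dotZr dot).
  set G := g _; set N := n.+1%:R => GH.
  have : (G - g xs) * N <= (2^-1 * g u + 2^-1 * g v - g xs) * N.
    by rewrite ler_wpM2r// lerD2r.
  lra.
have near_lim (c : R) : 0 < c -> exists N : nat, l - m N < c /\ N.+1%:R^-1 < c.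
  move=> c_gt0.
  have /cvgrPdist_lt /(_ _ c_gt0) near_m := m_cvg.
  have near_inv := near_infty_natSinv_lt (PosNum c_gt0).
  have [N _ NP] := filterI near_m near_inv.
  exists N; have [] := NP N (leqnn N).
  by rewrite ger0_norm ?subr_ge0// => ? ?.
have w_cvg : cvgn w.
  apply/cauchy_cvgP/cauchy_exP => e e_gt0.
  (* Since F N (w n) <= F n (w n), the bracket in [parallelogram N] is less than (l - m N) + 2 / (N
     + 1), that is, three quantities below e^2 / 12; the factor 4 gives e^2. *)
  have e2_gt0 : 0 < e ^+ 2 / 12 by rewrite divr_gt0// exprn_gt0.
  have [N [mN N_inv]] := near_lim _ e2_gt0.
  exists (w N), N => // n /= Nn.
  rewrite -ball_normE /= -(ltr_pXn2r (n := 2)) ?nnegrE ?(ltW e_gt0)//.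
  apply: le_lt_trans (parallelogram N _ _) _.
  have n_inv : n.+1%:R^-1 <= N.+1%:R^-1 :> R by rewrite lef_pV2 ?posrE// ler_nat.
  have := F_mono _ _ (w n) Nn; have := wP N; have := wP n; have := m_l n.
  move: n.+1%:R^-1 N.+1%:R^-1 n_inv N_inv mN => a b.
  lra.
set p := limn w in w_cvg.
have Fw n : F n (w n) <= l + n.+1%:R^-1.
  by apply: le_trans (ltW (wP n)) _; rewrite lerD2r.
have inv_cvg : n.+1%:R^-1 @[n --> \oo] --> (0 : R) by exact: cvg_harmonic.
have l_ge0 : 0 <= l by apply: le_trans (m_l 0%N); apply: lb_le_inf => //; exists (F 0%N 0), 0.
(* The weight n + 1 in [F n] forces g (w n) - g xs <= (l + 1) / (n + 1). *)
have gp : g p <= g xs.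
  have R_cvg : g xs + (l + 1) * n.+1%:R^-1 @[n --> \oo] --> g xs.
    rewrite -[X in _ --> X]addr0; apply: cvgD; first exact: cvg_cst.
    by rewrite -(mulr0 (l + 1)); apply: cvgM => //; exact: cvg_cst.
  apply: (ler_cvg_to (cvg_comp _ _ w_cvg (g_cont p)) R_cvg).
  apply: nearW => n; rewrite -lerBlDl ler_pdivlMr//=.
  have := Fw n; have := sq (w n); rewrite /F.
  have : n.+1%:R^-1 <= 1 :> R by rewrite invf_le1// ler1n.
  move: n.+1%:R n.+1%:R^-1 => a b.
  lra.
have p_argmin : argmin setT g p by split => // y _; rewrite (le_trans gp)// g_min.
have p_norm : `|p| ^+ 2 / 2 <= l.
  have L_cvg : `|w n| ^+ 2 / 2 @[n --> \oo] --> `|p| ^+ 2 / 2.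
    apply: cvgM; last exact: cvg_cst.
    by rewrite /GRing.exp; apply: cvgM; apply: cvg_norm.
  have R_cvg : l + n.+1%:R^-1 @[n --> \oo] --> l.
    by rewrite -[X in _ --> X]addr0; apply: cvgD => //; exact: cvg_cst.
  apply: (ler_cvg_to L_cvg R_cvg); apply: nearW => n.
  by apply: le_trans (Fw n); rewrite lerDr mulr_ge0.
have xs_l : `|xs| ^+ 2 / 2 <= l.
  apply: le_trans p_norm; rewrite ler_pM2r ?invr_gt0//.
  by rewrite lerXn2r ?nnegrE// norm_min.
have [N [mN _]] := near_lim _ eta_gt0.
(* For e <= 1 / (N + 1), the gap g y - g xs dominates e (N + 1) (g y - g xs), so the functional is
   at least g xs + e F N y, while F N y >= m N > |xs|^2 / 2 - eta. *)
exists N.+1%:R^-1; first by rewrite invr_gt0.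
move=> e y e_ge0 eN.
have : e * (`|xs| ^+ 2 / 2 - eta) <= e * F N y.
  by rewrite ler_wpM2l//; have := m_le N y; lra.
have : (e * N.+1%:R) * (g y - g xs) <= 1 * (g y - g xs).
  by rewrite ler_wpM2r// -ler_pdivlMr// div1r.
rewrite /F; lra.
Qed.

End convex_differentiable.

(** * Relative derivatives: interior points and continuity *)

Section is_derive_on.
Context {R : realType} {V : normedModType R}.

Lemma is_derive_on_interior (D : set R) (f df : R -> V) (t : R) :
  is_derive_on D f df -> D° t -> is_derive t 1 f (df t).
Proof.
move=> fdf Dt.
have L : h^-1 *: ((f \o shift t) (h *: 1) - f t) @[h --> 0^'] --> df t.
  move=> A At.
  have near_q : nbhs t [set s | s != t -> D s -> A ((s - t)^-1 *: (f s - f t))].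
    exact: fdf t (interior_subset Dt) A At.
  have : \forall s \near t, (s != t -> D s -> A ((s - t)^-1 *: (f s - f t))) /\ D s.
    exact: filterI near_q Dt.
  rewrite (near_shift 0) subr0.
  apply: filterS => h [/= Ah Dh] h0.
  rewrite /= [_%:A]mulr1; have := Ah _ Dh; rewrite addrK; apply.
  by rewrite -subr_eq0 addrK.
by split; [apply/cvg_ex; eexists; exact: L | exact: cvg_lim L].
Qed.

Lemma is_derive_on_continuous (D : set R) (f df : R -> V) :
  is_derive_on D f df -> {within D, continuous f}.
Proof.
move=> fdf; apply/subspace_continuousP => t Dt.
have st0 : s - t @[s --> (t : R)] --> (0 : R).
  by rewrite -(subrr t); apply: cvgB; [exact: cvg_id | exact: cvg_cst].
have L : (s - t) *: ((s - t)^-1 *: (f s - f t)) + f t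
    @[s --> within D t^'] --> 0 *: df t + f t.
  apply: cvgD; last exact: cvg_cst.
  apply: cvgZ; last exact: fdf.
  by do 2 apply: cvg_within_filter.
rewrite scale0r add0r in L.
move=> A At.
have near_q : nbhs t [set s | s != t -> D s ->
    A ((s - t) *: ((s - t)^-1 *: (f s - f t)) + f t)] by exact: L A At.
apply: filterS near_q => s /= As Ds.
(* The punctured filter says nothing at [t] itself, so that point is treated apart. *)
have [->|st] := eqVneq s t; first exact: nbhs_singleton.
by have := As st Ds; rewrite scalerA mulfV ?subr_eq0// scale1r subrK.
Qed.

End is_derive_on.

(** * Monotonicity and the sign of the derivative *)

Section nonincreasing.
Context {R : realType}.

Lemma is_derive_nincr (f df : R -> R) (a : R) :
  (forall t, a <= t -> is_derive t 1 f (df t)) -> (forall t, a <= t -> df t <= 0) ->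
  forall s t, a <= s -> s <= t -> f t <= f s.
Proof.
move=> fdf df_le0; apply: ler0_derive1_nincry.
- by move=> s; rewrite in_itv/= andbT => /ltW/fdf[].
- move=> s; rewrite in_itv/= andbT => /ltW sa.
  by rewrite derive1E; case: (fdf s sa) => _ ->; exact: df_le0.
- by apply: derivable_within_continuous => s; rewrite in_itv/= andbT => /fdf[].
Qed.

Lemma nincr_is_derive_le0 (f : R -> R) (a t d : R) : a < t ->
  (forall s u, a <= s -> s <= u -> f u <= f s) -> is_derive t 1 f d -> d <= 0.
Proof.
move=> at_ f_nincr [+ fd]; rewrite /derivable => /cvg_dnbhs_at_right.
rewrite -/(derive f t 1) fd => L.
apply: (cvgr_to_le L); near=> h.
have h0 : 0 < h by [].
rewrite -[leLHS]/(h^-1 * _) pmulr_rle0 ?invr_gt0// subr_le0 /= [_%:A]mulr1.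
by apply: f_nincr; [exact: ltW | rewrite lerDr ltW].
Unshelve. all: by end_near. Qed.

End nonincreasing.

(** * Integrals with a variable upper bound *)

Section integral_upto.
Context {R : realType}.
Notation mu := (@lebesgue_measure R).
Variables (f : R -> R) (a : R).
Hypothesis f_cont : {within `[a, +oo[, continuous f}.

Lemma integrable_segment (b : R) : mu.-integrable `[a, b] (EFin \o f).
Proof.
apply: continuous_compact_integrable; first exact: segment_compact.
by apply: continuous_subspaceW f_cont; apply: subset_itvl.
Qed.

Lemma is_derive_integral_upto (t : R) : a < t ->
  is_derive t 1 (fun t => \int[mu]_(s in `[a, t]) f s) (f t).
Proof.
move=> ta.
have ft : {for t, continuous f}.
  have /continuous_within_itvcyP[f_in _] := f_cont.
  by apply: f_in; rewrite in_itv/= andbT.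
have tt1 : t < t + 1 by rewrite ltrDl.
have [D1 D2] := continuous_FTC1_closed tt1 (integrable_segment _) ta ft.
by split; [exact: D1 | rewrite -derive1E; exact: D2].
Qed.

Hypothesis f_ge0 : forall t, a <= t -> 0 <= f t.

Lemma integral_upto_ge0 (t : R) : 0 <= \int[mu]_(s in `[a, t]) f s.
Proof.
by apply: Rintegral_ge0 => s /=; rewrite in_itv/= => /andP[/f_ge0].
Qed.

Lemma integral_upto_ndecr :
  {homo (fun t => \int[mu]_(s in `[a, t]) f s) : s t / s <= t}.
Proof.
move=> s t st.
(* Monotonicity is wanted on the whole line; for s < a the segment is empty and the integral is
   0. *)
have [as_|sa] := leP a s; last first.
  rewrite [leLHS](_ : _ = 0) ?integral_upto_ge0//.
  by rewrite set_itv_ge ?Rintegral_set0// -leNgt bnd_simp.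
rewrite -subr_ge0 Rintegral_itvB ?bnd_simp//; last exact: integrable_segment.
apply: Rintegral_ge0 => u /=; rewrite in_itv/= => /andP[/ltW su _].
exact/f_ge0/(le_trans as_).
Qed.

(** Otherwise the monotone primitive is bounded and converges, and the fundamental theorem of
    calculus on the half-line makes the improper integral finite. *)
Lemma integral_upto_cvgy : (\int[mu]_(t in `[a, +oo[) (f t)%:E = +oo)%E ->
  \int[mu]_(s in `[a, t]) f s @[t --> +oo] --> +oo.
Proof.
pose I t := \int[mu]_(s in `[a, t]) f s; move=> f_int.
apply/cvgryPge => A; apply: contrapT => nearA.
have I_ub : has_ubound (range I).
  exists A => _ [t _ <-]; rewrite leNgt; apply/negP => At.
  apply: nearA; exists t; split; first exact: num_real.
  move=> s /ltW ts; apply: (le_trans (ltW At)); exact: integral_upto_ndecr.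
have I_cvg := nondecreasing_cvgr integral_upto_ndecr I_ub.
have Ia : I a = 0 by rewrite /I set_itv1 Rintegral_set1.
have Ia_cvg : I t @[t --> a^'+] --> I a.
  rewrite Ia; apply: cvg_at_right_filter.
  apply: (parameterized_integral_cvg_left (b := a + 1)); first by rewrite ltrDl.
  exact: integrable_segment.
suff : (+oo = (sup (range I))%:E - (I a)%:E)%E by [].
rewrite -f_int; apply: ge0_continuous_FTC2y => // t.
- by move=> /is_derive_integral_upto[].
- rewrite in_itv/= andbT => /is_derive_integral_upto[_ <-].
  by rewrite derive1E.
Qed.

End integral_upto.

(** * Energy estimates along the trajectory *)

Section damped_tikhonov_flow.
Context {R : realType} {H : completeNormedModType R} (dot : {dot H for idfun}).
Hypothesis dotE : hilbert_norm dot.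
Variables (g : H -> R) (alpha beta t0 : R) (eps deps : R -> R).
Variables (x dx ddx : R -> H) (xs : H).
Hypothesis g_convex : convex_function (setT : set (convex_lmodType H)) g.
Hypothesis g_diff2 : twice_differentiable dot g.
Hypotheses (alpha_gt0 : 0 < alpha) (beta_ge0 : 0 <= beta) (t0_gt0 : 0 < t0).
Hypothesis eps_ge0 : forall t, t0 <= t -> 0 <= eps t.
Hypothesis eps_nincr : forall s t, t0 <= s -> s <= t -> eps t <= eps s.
Hypothesis eps_deps : is_derive_on `[t0, +oo[ eps deps.
Hypothesis x_dx : is_derive_on `[t0, +oo[ x dx.
Hypothesis dx_ddx : is_derive_on `[t0, +oo[ dx ddx.
Hypothesis x_ode : forall t, t0 <= t ->
  ddx t + (alpha / t) *: dx t + beta *: hessian dot g (x t) (dx t)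
    + gradient dot g (x t) + eps t *: x t = 0.
Hypothesis xs_min : forall y, g xs <= g y.

Definition bregman_gap t :=
  dot (gradient dot g (x t)) (x t - xs) - (g (x t) - g xs).

Definition mechanical_energy t := dot (dx t) (dx t) / 2 + (g (x t) - g xs)
  + eps t * (dot (x t) (x t) / 2).

(** The factor 1 + alpha cancels the two h' / t^2 terms, one from differentiating 1 / t in h' / t
    and one from the damping; the factor 1 / alpha turns the dissipation of W into - |x'|^2 / t. *)
Definition lyapunov t :=
  t^-1 * (dot (dx t) (x t - xs) + beta * bregman_gap t)
  + (1 + alpha) * (t^-1 * t^-1 * (dot (x t - xs) (x t - xs) / 2))
  + alpha^-1 * mechanical_energy t.

Lemma dot_ge0 u : 0 <= dot u u.
Proof. by rewrite -dotE sqr_ge0. Qed.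

Lemma bregman_gap_ge0 t : 0 <= bregman_gap t.
Proof.
have := convex_gradient_le dot dotE g g_convex (x t) xs (g_diff2.1 _).
rewrite -opprB (dotNr dot) /bregman_gap; lra.
Qed.

Lemma lyapunov_ge0 t : t0 <= t -> 0 <= lyapunov t.
Proof.
move=> tt0.
have t_gt0 : 0 < t := lt_le_trans t0_gt0 tt0.
rewrite /lyapunov; set q := t^-1.
have q_ge0 : 0 <= q by rewrite invr_ge0 ltW.
move: (x t - xs) => Y.
have gap : 0 <= q * (beta * bregman_gap t).
  by rewrite !mulr_ge0// bregman_gap_ge0.
have energy_ge : alpha^-1 * (dot (dx t) (dx t) / 2) <= alpha^-1 * mechanical_energy t.
  rewrite ler_pM2l ?invr_gt0// /mechanical_energy -addrA lerDl.
  by rewrite addr_ge0 ?subr_ge0// mulr_ge0 ?eps_ge0// divr_ge0// dot_ge0.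
have YY : 0 <= q * q * (dot Y Y / 2) by rewrite !mulr_ge0// dot_ge0.
(* [|x' + (alpha / t) (x - xs)|^2 >= 0] absorbs the indefinite term [h' / t]. *)
have : 0 <= alpha^-1 * dot (dx t + (alpha * q) *: Y) (dx t + (alpha * q) *: Y) / 2.
  by rewrite !mulr_ge0// ?invr_ge0 ?(ltW alpha_gt0) ?dot_ge0.
have -> : alpha^-1 * dot (dx t + (alpha * q) *: Y) (dx t + (alpha * q) *: Y) / 2
  = alpha^-1 * (dot (dx t) (dx t) / 2) + q * dot (dx t) Y + alpha * (q * q * (dot Y Y / 2)).
  rewrite !(dotDl dot) !(dotDr dot) !(dotZl dot) !(dotZr dot) (dotC dot Y (dx t)).
  by field; rewrite gt_eqF.
move: gap energy_ge YY; lra.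
Qed.

(** The second hypothesis is the bound of [tikhonov_lower_bound] at time [t]. The strict inequality
    t0 < t makes [t] interior, so that two-sided derivatives exist. *)
Lemma lyapunov_derive t eta : t0 < t ->
  g xs + eps t * (`|xs| ^+ 2 / 2 - eta) <= g (x t) + eps t * (`|x t| ^+ 2 / 2) ->
  exists2 d, is_derive t 1 lyapunov d
    & d <= eps t / t * (eta - `|x t - xs| ^+ 2 / 2).
Proof.
move=> t0t tik.
have t_gt0 : 0 < t := lt_trans t0_gt0 t0t.
have t_int : (`[t0, +oo[%classic : set R)° t.
  by rewrite interior_itv// /= in_itv/= t0t.
have Dx := is_derive_on_interior _ _ _ _ x_dx t_int.
have Ddx := is_derive_on_interior _ _ _ _ dx_ddx t_int.
have Deps := is_derive_on_interior _ _ _ _ eps_deps t_int.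
have Dgrad : is_derive t 1 (fun s => gradient dot g (x s))
    (hessian dot g (x t) (dx t)).
  exact: is_derive_diff_comp Dx (g_diff2.2 _).
have Dg : is_derive t 1 (fun s => g (x s)) (dot (gradient dot g (x t)) (dx t)).
  rewrite -(gradientP dotE (g_diff2.1 _)).
  exact: is_derive_diff_comp Dx (g_diff2.1 _).
have Dy : is_derive t 1 (fun s => x s - xs) (dx t).
  by have := is_deriveB Dx (is_derive_cst xs t 1); rewrite subr0; exact.
have Dgap : is_derive t 1 bregman_gap
    (dot (hessian dot g (x t) (dx t)) (x t - xs)).
  have := is_deriveB (is_derive_dot dot dotE _ _ _ _ _ Dgrad Dy)
    (is_deriveB Dg (is_derive_cst (g xs) t 1)).
  by rewrite subr0 addrK; exact.
have Dp := is_derive_dot dot dotE _ _ _ _ _ Ddx Dy.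
have Dyy := is_derive_dot dot dotE _ _ _ _ _ Dy Dy.
have Dvv := is_derive_dot dot dotE _ _ _ _ _ Ddx Ddx.
have Dxx := is_derive_dot dot dotE _ _ _ _ _ Dx Dx.
have Dinv : is_derive t 1 (fun s : R => s^-1) (- (t^-1 * t^-1)).
  have := is_deriveV (f := id) (lt0r_neq0 t_gt0) (is_derive_id t 1).
  by rewrite /GRing.scale/= mulr1 expr2 invfM; exact.
have deps_le0 := nincr_is_derive_le0 _ _ _ _ t0t eps_nincr Deps.
have D1 := is_deriveM Dinv (is_deriveD Dp (is_deriveZ beta Dgap)).
have D2 := is_deriveZ (1 + alpha) (is_deriveM (is_deriveM Dinv Dinv)
  (is_deriveM Dyy (is_derive_cst (2^-1 : R) t 1))).
have D3 := is_deriveZ alpha^-1 (is_deriveD (is_deriveD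
  (is_deriveM Dvv (is_derive_cst (2^-1 : R) t 1)) (is_deriveB Dg (is_derive_cst (g xs) t 1)))
  (is_deriveM Deps (is_deriveM Dxx (is_derive_cst (2^-1 : R) t 1)))).
eexists; first exact: is_deriveD (is_deriveD D1 D2) D3.
rewrite !fctE /= /GRing.scale /=.
(* The equation paired with [w], for use with both x - xs (in h'') and x' (in W'). *)
have dot_ddx w : dot (ddx t) w = - (alpha * t^-1 * dot (dx t) w)
    - beta * dot (hessian dot g (x t) (dx t)) w
    - dot (gradient dot g (x t)) w - eps t * dot (x t) w.
  have := congr1 (dot ^~ w) (x_ode _ (ltW t0t)).
  rewrite !(dotDl dot) !(dotZl dot) -(scale0r w) (dotZl dot) mul0r => E.
  by rewrite -[LHS]subr0 -E; ring.
rewrite (dotC dot (dx t) (ddx t)) !dot_ddx (dotC dot (dx t) (x t)).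
rewrite (dotC dot (x t - xs) (dx t)).
have gap_ge0 := bregman_gap_ge0 t.
have gapE : bregman_gap t = dot (gradient dot g (x t)) (x t - xs) - (g (x t) - g xs).
  by [].
have hess_ge0 := hessian_ge0 dot dotE g g_convex (x t) (dx t) g_diff2.
have xs_sqr : dot xs xs = dot (x t) (x t) + dot (x t - xs) (x t - xs)
    - 2 * dot (x t) (x t - xs).
  have := sqr_normB dot dotE (x t) (x t - xs).
  by rewrite opprB addrCA subrr addr0 !dotE.
have q_ge0 : 0 <= t^-1 by rewrite invr_ge0 ltW.
have xx_ge0 := dot_ge0 (x t); have yy_ge0 := dot_ge0 (x t - xs).
(* Nonnegativity of the Bregman gap is added to [tik], in which |xs|^2 is expanded around x(t). *)
have grad_ge : eps t * (dot (x t - xs) (x t - xs) / 2 - eta)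
    <= dot (gradient dot g (x t)) (x t - xs) + eps t * dot (x t) (x t - xs).
  by move: tik gapE; rewrite !dotE xs_sqr; lra.
rewrite dotE.
move: (bregman_gap t) (dot (x t) (x t)) (dot (x t - xs) (x t - xs)) (t^-1)
  (dot (hessian dot g (x t) (dx t)) (dx t)) (dot (x t) (x t - xs))
  (dot (gradient dot g (x t)) (x t - xs)) gap_ge0 xx_ge0 yy_ge0 q_ge0 hess_ge0 grad_ge.
move=> K xx yy q hv xY gY K_ge0 xx_ge0 yy_ge0 q_ge0 hv_ge0 grad_ge.
(* The slack in the claimed inequality is exactly the sum of five nonnegative terms: the regularized
   gradient estimate, beta K / t^2 and (1 + alpha) |x - xs|^2 / t^3 from the decreasing weights, the
   Hessian dissipation, and the decrease of eps. *)
have bound1 : q * (eps t * (yy / 2 - eta)) <= q * (gY + eps t * xY).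
  by rewrite ler_wpM2l.
have bound2 : 0 <= q ^+ 2 * beta * K by rewrite !mulr_ge0// sqr_ge0.
have bound3 : 0 <= (1 + alpha) * q ^+ 3 * yy.
  by rewrite !mulr_ge0// ?exprn_ge0// addr_ge0// ltW.
have bound4 : 0 <= alpha^-1 * (beta * hv) by rewrite !mulr_ge0// invr_ge0 ltW.
have bound5 : 0 <= alpha^-1 * (- deps t * (xx / 2)).
  by rewrite !mulr_ge0// ?invr_ge0 ?oppr_ge0// ltW.
rewrite -subr_ge0.
have nonneg e : e = q * (gY + eps t * xY) - q * (eps t * (yy / 2 - eta))
    + q ^+ 2 * beta * K + (1 + alpha) * q ^+ 3 * yy + alpha^-1 * (beta * hv)
    + alpha^-1 * (- deps t * (xx / 2)) -> 0 <= e.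
  by move=> ->; move: bound1 bound2 bound3 bound4 bound5; lra.
by apply: nonneg; field; rewrite gt_eqF.
Qed.

Notation mu := (@lebesgue_measure R).

Lemma eps_div_ge0 t : t0 <= t -> 0 <= eps t / t.
Proof.
by move=> tt0; rewrite divr_ge0 ?eps_ge0// (le_trans (ltW t0_gt0)).
Qed.

Lemma eps_div_continuous : {within `[t0, +oo[, continuous (fun t => eps t / t)}.
Proof.
apply/subspace_continuousP => t tt0.
have t_gt0 : 0 < t.
  by move: tt0; rewrite /= in_itv/= andbT; exact: lt_le_trans.
apply: cvgM.
  exact: (subspace_continuousP _ _).1 (is_derive_on_continuous _ _ _ eps_deps) t tt0.
by apply: cvgV; [rewrite gt_eqF | exact: cvg_within].
Qed.

Lemma weighted_error_continuous :
  {within `[t0, +oo[, continuous (fun t => eps t / t * `|x t - xs| ^+ 2)}.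
Proof.
apply/subspace_continuousP => t tt0.
have xt : `|x s - xs| @[s --> within `[t0, +oo[ (nbhs t)] --> `|x t - xs|.
  apply: cvg_norm; apply: cvgB; last exact: cvg_cst.
  exact: (subspace_continuousP _ _).1 (is_derive_on_continuous _ _ _ x_dx) t tt0.
apply: cvgM; first exact: (subspace_continuousP _ _).1 eps_div_continuous t tt0.
by rewrite /GRing.exp; apply: cvgM.
Qed.

Lemma is_derive_weight_integral t : t0 < t ->
  is_derive t 1 (fun t => \int[mu]_(s in `[t0, t]) (eps s / s)) (eps t / t).
Proof.
by move=> ?; apply: is_derive_integral_upto => //; exact: eps_div_continuous.
Qed.

Lemma is_derive_weighted_error_integral t : t0 < t ->
  is_derive t 1 (fun t => \int[mu]_(s in `[t0, t]) (eps s / s * `|x s - xs| ^+ 2))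
    (eps t / t * `|x t - xs| ^+ 2).
Proof.
by move=> ?; apply: is_derive_integral_upto => //; exact: weighted_error_continuous.
Qed.

Hypothesis eps_cvg0 : eps t @[t --> +oo] --> 0.
Hypothesis xs_minnorm : argmin (argmin setT g) (fun y => `|y|) xs.

(** Integrates [lyapunov_derive] from a time [T] after which the Tikhonov bound holds; [eta] is
    halved there because h carries a factor 1/2. *)
Lemma weighted_error_bound eta : 0 < eta -> exists C, \forall t \near +oo,
  \int[mu]_(s in `[t0, t]) (eps s / s * `|x s - xs| ^+ 2)
    <= eta * \int[mu]_(s in `[t0, t]) (eps s / s) + C.
Proof.
move=> eta_gt0.
have g_cont : continuous g.
  by move=> y; apply: differentiable_continuous; exact: g_diff2.1.
have [d d_gt0 tik] := tikhonov_lower_bound dot dotE g g_convex xs (eta / 2)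
  g_cont xs_minnorm (divr_gt0 eta_gt0 (ltr0n _ 2)).
have [M [_ epsM]] := cvgr_le _ eps_cvg0 d d_gt0.
(* Adding 1 puts every t >= T strictly beyond both [M] and [t0]. *)
pose T := Num.max M t0 + 1.
have T_gt t : T <= t -> t0 < t /\ M < t.
  rewrite /T => tT; have : Num.max M t0 < t by apply: lt_le_trans tT; rewrite ltrDl.
  by rewrite gt_max => /andP[].
have tikT t : T <= t -> g xs + eps t * (`|xs| ^+ 2 / 2 - eta / 2)
    <= g (x t) + eps t * (`|x t| ^+ 2 / 2).
  by move=> /T_gt[t0t Mt]; apply: tik; [exact/eps_ge0/ltW | exact: epsM].
pose A t := \int[mu]_(s in `[t0, t]) (eps s / s).
pose B t := \int[mu]_(s in `[t0, t]) (eps s / s * `|x s - xs| ^+ 2).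
(* The added integrals exactly compensate the bound on the derivative of [lyapunov], so [Psi] is
   nonincreasing after [T]. *)
pose Psi := lyapunov + (2^-1 \*: B - (eta / 2) \*: A).
have Psi_derive t : T <= t -> exists2 e, is_derive t 1 Psi e & e <= 0.
  move=> tT; have [t0t _] := T_gt t tT.
  have [e De e_le] := lyapunov_derive t _ t0t (tikT t tT).
  have DB := is_deriveZ 2^-1 (is_derive_weighted_error_integral t t0t).
  have DA := is_deriveZ (eta / 2) (is_derive_weight_integral t t0t).
  eexists; first exact: is_deriveD De (is_deriveB DB DA).
  by rewrite /GRing.scale/=; move: (eps t / t) e_le => q; lra.
have /choice[dPsi dPsiP] : forall t, exists e, T <= t -> is_derive t 1 Psi e /\ e <= 0.
  move=> t; have [/Psi_derive[e ? ?]|_] := boolP (T <= t); first by exists e.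
  by exists 0.
(* As [lyapunov t] is nonnegative, B t / 2 - (eta / 2) A t <= Psi t <= Psi T. *)
exists (2 * Psi T); exists T; split; first exact: num_real.
move=> t /ltW Tt.
have := is_derive_nincr Psi dPsi T (fun t h => (dPsiP t h).1)
  (fun t h => (dPsiP t h).2) T t (lexx _) Tt.
have := lyapunov_ge0 _ (ltW (T_gt t Tt).1).
have -> : Psi t = lyapunov t + (2^-1 * B t - eta / 2 * A t) by [].
rewrite -/(A t) -/(B t); move: (Psi T) => C; lra.
Qed.

End damped_tikhonov_flow.

(** * Weighted averages and lower limits *)

Section weighted_average.
Context {R : realType}.

Lemma average_cvg0 (A B : R -> R) : A t @[t --> +oo] --> +oo ->
  (forall t, 0 <= B t) ->
  (forall eta, 0 < eta -> exists C, \forall t \near +oo, B t <= eta * A t + C) ->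
  (A t)^-1 * B t @[t --> +oo] --> 0.
Proof.
move=> A_cvg B_ge0 AB; apply/cvgr0Pnorm_le => e e_gt0.
have e2_gt0 : 0 < e / 2 by rewrite divr_gt0.
have [C BC] := AB _ e2_gt0.
near=> t.
have A_gt0 : 0 < A t by near: t; move/cvgryPgt : A_cvg; exact.
(* Half of [e] pays for [eta], the other half absorbs the constant [C] once [A t] is large. *)
have A_C : C / (e / 2) <= A t by near: t; move/cvgryPge : A_cvg; exact.
have Bt : B t <= e / 2 * A t + C by near: t.
have AV_ge0 : 0 <= (A t)^-1 by rewrite invr_ge0 ltW.
rewrite ger0_norm ?mulr_ge0// ler_pdivrMl//.
by move: A_C; rewrite ler_pdivrMr//; lra.
Unshelve. all: by end_near. Qed.

Lemma limf_einf_eq0 (f : R -> R) : (forall t, 0 <= f t) ->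
  (forall c, 0 < c -> ~ \forall t \near +oo, c <= f t) ->
  limf_einf (fun t => (f t)%:E) (pinfty_nbhs R) = 0%E.
Proof.
move=> f_ge0 f_lt; rewrite limf_einfE; apply/eqP; rewrite eq_le; apply/andP; split.
  apply: ge_ereal_sup => _ [V near_V <-]; rewrite leNgt; apply/negP => inf_gt0.
  (* The infimum is an extended real; if it is infinite, any positive [c] will do, here 1. *)
  have [c c_gt0 c_le] : exists2 c, 0 < c & (c%:E <= ereal_inf ((EFin \o f) @` V))%E.
    move: inf_gt0; case: ereal_inf => [r| |]//.
      by rewrite lte_fin => r_gt0; exists r.
    by exists 1; rewrite ?leey.
  apply: (f_lt c c_gt0); apply: filterS near_V => t Vt.
  by rewrite -lee_fin; apply: (le_trans c_le); apply: ereal_inf_lbound; exists t.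
apply: le_trans (ereal_sup_ubound _); last by exists setT; [exact: filterT | reflexivity].
by apply: le_ereal_inf_tmp => _ [t _ <-]; rewrite lee_fin.
Qed.

End weighted_average.

Theorem theorem4p2 (R : realType) (H : completeNormedModType R)
    (dot : {dot H for idfun}) (Hdot : hilbert_norm dot)
    (g : H -> R)
    (g_convex : convex_function (setT : set (convex_lmodType H)) g)
    (g_diff2 : twice_differentiable dot g)
    (grad_lip : forall B : set H, bounded_set B ->
      [lipschitz gradient dot g y | y in B])
    (g_argmin : argmin setT g !=set0)
    (alpha beta t0 : R) (beta_ge0 : 0 <= beta) (t0_gt0 : 0 < t0)
    (eps : R -> R)
    (eps_ge0 : forall t, t0 <= t -> 0 <= eps t)
    (eps_nincr : forall s t, t0 <= s -> s <= t -> eps t <= eps s)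
    (eps_C1 : continuously_differentiable_on `[t0, +oo[ eps)
    (eps_cvg0 : eps t @[t --> +oo] --> 0)
    (u0 v0 : H) (x dx ddx : R -> H)
    (x_dx : is_derive_on `[t0, +oo[ x dx)
    (dx_ddx : is_derive_on `[t0, +oo[ dx ddx)
    (ddx_cont : {within `[t0, +oo[, continuous ddx})
    (x_ode : forall t, t0 <= t ->
      ddx t + (alpha / t) *: dx t + beta *: hessian dot g (x t) (dx t)
        + gradient dot g (x t) + eps t *: x t = 0)
    (x_t0 : x t0 = u0) (dx_t0 : dx t0 = v0)
    (eps_int : (\int[lebesgue_measure]_(t in `[t0, +oo[) (eps t / t)%:E = +oo)%E)
    (xs : H) (xs_minnorm : argmin (argmin setT g) (fun y => `|y|) xs)
    (alpha_gt0 : 0 < alpha) :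
  (\int[lebesgue_measure]_(s in `[t0, t]) (eps s / s))^-1
    * (\int[lebesgue_measure]_(s in `[t0, t]) (eps s / s * `|x s - xs| ^+ 2))
    @[t --> +oo] --> 0
  /\ limf_einf (fun t => `|x t - xs|%:E) (pinfty_nbhs R) = 0%E.
Proof.
have [deps [eps_deps _]] := eps_C1.
have xs_min y : g xs <= g y by case: xs_minnorm => -[_ +] _; exact.
pose A t := \int[lebesgue_measure]_(s in `[t0, t]) (eps s / s).
pose B t := \int[lebesgue_measure]_(s in `[t0, t]) (eps s / s * `|x s - xs| ^+ 2).
have A_cvgy : A t @[t --> +oo] --> +oo.
  apply: (integral_upto_cvgy (fun s => eps s / s)) => //.
  - exact: (eps_div_continuous _ _ deps).
  - exact: (eps_div_ge0 t0).
have B_ge0 t : 0 <= B t.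
  apply: integral_upto_ge0 => s s_ge; rewrite mulr_ge0 ?sqr_ge0//.
  exact: (eps_div_ge0 t0).
have AB_cvg : (A t)^-1 * B t @[t --> +oo] --> 0.
  apply: average_cvg0 => // eta eta_gt0.
  exact: (weighted_error_bound dot Hdot g alpha beta t0 eps deps x dx ddx).
(* If |x - xs| >= c eventually, then c^2 A - B is nonincreasing from some time on, hence bounded
   above by a constant [C]. Once A > 2 C / c^2 this gives B > (c^2 / 2) A, against the vanishing of
   the average. *)
split=> //; apply: limf_einf_eq0 => [t|c c_gt0 [M [_ c_le]]]; first exact: normr_ge0.
pose T := Num.max M t0 + 1.
have T_gt t : T <= t -> M < t /\ t0 < t.
  rewrite /T => tT; have : Num.max M t0 < t by apply: lt_le_trans tT; rewrite ltrDl.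
  by rewrite gt_max => /andP[].
have c2_gt0 : 0 < c ^+ 2 by rewrite exprn_gt0.
have diff_le t : T <= t -> c ^+ 2 * A t - B t <= c ^+ 2 * A T - B T.
  move=> Tt; apply: (is_derive_nincr (c ^+ 2 \*: A - B)
    (fun t => c ^+ 2 *: (eps t / t) - eps t / t * `|x t - xs| ^+ 2) T _ _ T t) => //.
    move=> s /T_gt[_ t0s]; apply: is_deriveB.
      by apply: is_deriveZ; exact: (is_derive_weight_integral _ _ deps).
    exact: (is_derive_weighted_error_integral _ _ deps _ dx).
  move=> s /T_gt[Ms t0s]; rewrite /GRing.scale/= subr_le0 mulrC ler_wpM2l//.
    by apply: (eps_div_ge0 t0) => //; exact: ltW.
  by rewrite lerXn2r ?nnegrE ?normr_ge0 ?(ltW c_gt0)// c_le.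
set C := c ^+ 2 * A T - B T in diff_le.
have c4_gt0 : 0 < c ^+ 2 / 2 by rewrite divr_gt0.
near +oo_R => t.
have Tt : T <= t by [].
have A_gt0 : 0 < A t by near: t; move/cvgryPgt : A_cvgy; exact.
have A_C : C / (c ^+ 2 / 2) < A t by near: t; move/cvgryPgt : A_cvgy; exact.
have : (A t)^-1 * B t <= c ^+ 2 / 2 by near: t; exact: cvgr_le AB_cvg _ c4_gt0.
rewrite ler_pdivrMl//; move: A_C (diff_le t Tt); rewrite ltr_pdivrMr//; lra.
Unshelve. all: by end_near. Qed.
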